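(* Let $a$ be a fixed integer $\ge 2$, and suppose $b$ tends to infinity through squarefree values. Then $$c_{a,b}=\left(1-\frac1a\right)b+O(1),$$ and, for any fixed integer $n\ge 1$, $$p_{a,b}(n)=\left(1-\frac1a\right)nb+\frac{b}{a}+O(1).$$ Here the implied constants may depend on the fixed quantities ($a$ in the first estimate, $a$ and $n$ in the second) but not on $b$.
   Context: For an integer $b\ge 3$ and a real $x>0$, the leading digit $D_b(x)\in\{1,2,\dots,b-1\}$ of $x$ in base $b$ is defined by: $D_b(x)=d$ if and only if $d\cdot b^j\le x<(d+1)b^j$ for some $j\in\mathbb{Z}$. For real $a>0$, the leading digit sequence is $S_{a,b}=\{D_b(a^n)\}_{n=1}^\infty$. Its (block) complexity function is $$p_{a,b}(n)=\#\{(D_b(a^m),D_b(a^{m+1}),\dots,D_b(a^{m+n-1})): m=1,2,\dots\},$$ the number of distinct blocks of $n$ consecutive terms occurring in $S_{a,b}$. For a squarefree integer $b\ge5$ and a positive rational $a$ that is not an integral power of $b$ (this holds whenever $a\ge 2$ is an integer and $b>a$), write uniquely $a=\frac{r}{s}b^k$ with $k\in\mathbb{Z}$, $r,s\in\mathbb{N}$, $\gcd(r,s)=1$, $1<\frac rs<b$, and set $$c_{a,b}=b-1-\left\lfloor\frac{b-1}{r}\right\rfloor-\left\lfloor\frac{\gcd(b,r)-1}{s}\right\rfloor.$$ *)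

(* Defs.v *)
From HB Require Import structures.
From mathcomp Require Import all_boot all_order all_algebra.
From mathcomp Require Import finmap.
From mathcomp Require Import all_classical all_reals all_analysis.
From mathcomp Require Import zify ring lra.

Set Implicit Arguments.
Unset Strict Implicit.
Unset Printing Implicit Defensive.

Import Order.TTheory GRing.Theory Num.Theory.
Local Open Scope classical_set_scope.
Local Open Scope ring_scope.

Definition squarefree (n : nat) : Prop :=
  forall d : nat, (d ^ 2 %| n)%N -> d = 1%N.

Definition is_leading_digit (R : realType) (b : nat) (x : R) (d : nat) : Prop :=
  (1 <= d <= b - 1)%N /\
  exists j : int, d%:R * b%:R ^ j <= x < d.+1%:R * b%:R ^ j.

(* The digit exists for 1 < b and 0 < x and is unique by leading_digit_uniq, so
   the default 0 is never taken there. *)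
Definition leading_digit (R : realType) (b : nat) (x : R) : nat :=
  xget 0%N [set d | is_leading_digit b x d].

Definition block (R : realType) (a : R) (b n m : nat) : n.-tuple nat :=
  [tuple leading_digit b (a ^+ (m + i)) | i < n].

(* fset_set is a junk value on infinite sets; this one is finite by
   finite_blocks. *)
Definition complexity (R : realType) (a : R) (b n : nat) : nat :=
  #|` fset_set [set block a b n m | m in [set m | (1 <= m)%N]] |.

Definition is_decomposition (a : rat) (b r s : nat) (k : int) : Prop :=
  [/\ a = r%:R / s%:R * b%:R ^ k, (0 < r)%N, (0 < s)%N, coprime r s
    & 1 < (r%:R / s%:R : rat) < b%:R].

(* At most one decomposition exists, by decomposition_uniq; it exists for 2 <= b
   and 0 < a not an integral power of b, and (1, 1) is a default elsewhere. *)
Definition decomposition (a : rat) (b : nat) : nat * nat :=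
  xget (1%N, 1%N) [set rs | exists k : int, is_decomposition a b rs.1 rs.2 k].

(* Integer-valued, so that none of the outer subtractions truncates. *)
Definition c_coef (a : rat) (b : nat) : int :=
  let: (r, s) := decomposition a b in
  b%:Z - 1 - ((b - 1) %/ r)%N%:Z - ((gcdn b r - 1) %/ s)%N%:Z.

Lemma leading_digit_le (R : realType) (b : nat) (x : R) :
  (leading_digit b x <= b - 1)%N.
Proof.
rewrite /leading_digit; case: xgetP => [d _ [/andP[]]|] //.
Qed.

Lemma finite_blocks (R : realType) (a : R) (b n : nat) :
  finite_set [set block a b n m | m in [set m | (1 <= m)%N]].
Proof.
pose f (w : n.-tuple 'I_(b - 1).+1) : n.-tuple nat := map_tuple val w.
apply: (@sub_finite_set _ _ (f @` [set: n.-tuple 'I_(b - 1).+1])); last first.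
  by apply: finite_image; exact: finite_finset.
move=> _ [m _ <-].
exists [tuple inord (leading_digit b (a ^+ (m + i))) | i < n] => //.
apply: eq_from_tnth => i.
by rewrite tnth_map !tnth_mktuple /= inordK // ltnS leading_digit_le.
Qed.

Lemma scale_le (F : realFieldType) (b : nat) (u v x : F) (j k : int) :
  (1 < b)%N -> 1 <= u -> v <= b%:R -> u * b%:R ^ j <= x -> x < v * b%:R ^ k ->
  j <= k.
Proof.
move=> b1 u1 vb h1 h2; rewrite leNgt; apply/negP => kj.
have b1R : 1 <= b%:R :> F by rewrite ler1n; lia.
have b0 : 0 < b%:R :> F by apply: lt_le_trans b1R.
have h3 : b%:R ^ j <= x.
  by apply: le_trans h1; rewrite ler_peMl // exprz_ge0 // ltW.
have h4 : v * b%:R ^ k <= b%:R ^ j.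
  apply: le_trans (_ : b%:R ^ (k + 1) <= _); last first.
    by apply: ler_weXz2l => //; rewrite -ltzD1 ltrD2r.
  by rewrite expfzDr ?gt_eqF// expr1z mulrC ler_pM2l ?exprz_gt0.
by move: (le_lt_trans h3 (lt_le_trans h2 h4)); rewrite ltxx.
Qed.

Lemma leading_digit_uniq (R : realType) (b : nat) (x : R) (d e : nat) :
  is_leading_digit b x d -> is_leading_digit b x e -> d = e.
Proof.
move=> [hd [j /andP[dj1 dj2]]] [he [k /andP[ek1 ek2]]].
have b1 : (1 < b)%N by lia.
have d1 : 1 <= d%:R :> R by rewrite ler1n; lia.
have e1 : 1 <= e%:R :> R by rewrite ler1n; lia.
have db : d.+1%:R <= b%:R :> R by rewrite ler_nat; lia.
have eb : e.+1%:R <= b%:R :> R by rewrite ler_nat; lia.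
have jk : j = k.
  apply/eqP; rewrite eq_le; apply/andP; split.
    exact: scale_le b1 d1 eb dj1 ek2.
  exact: scale_le b1 e1 db ek1 dj2.
subst k; have p0 : 0 < (b%:R : R) ^ j by rewrite exprz_gt0 // ltr0n; lia.
move: (le_lt_trans dj1 ek2) (le_lt_trans ek1 dj2).
rewrite !ltr_pM2r // !ltr_nat; lia.
Qed.

Lemma decomposition_uniq (a : rat) (b r s r' s' : nat) (k k' : int) :
  is_decomposition a b r s k -> is_decomposition a b r' s' k' ->
  [/\ r = r', s = s' & k = k'].
Proof.
move=> [ea r0 s0 co /andP[l1 l2]] [ea' r0' s0' co' /andP[l1' l2']].
have b1 : (1 < b)%N by rewrite -(ltr1n rat); exact: lt_trans l1 l2.
have b0 : 0 < (b%:R : rat) by rewrite ltr0n; lia.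
have kk : k = k'.
  apply/eqP; rewrite eq_le; apply/andP; split.
    apply: (@scale_le _ b _ b%:R a k k' b1 (ltW l1)); rewrite // ea //.
    by rewrite -ea ea' ltr_pM2r ?exprz_gt0.
  apply: (@scale_le _ b _ b%:R a k' k b1 (ltW l1')); rewrite // ea' //.
  by rewrite -ea' ea ltr_pM2r ?exprz_gt0.
subst k'; move: ea'; rewrite ea => /mulIf; rewrite expfz_neq0 ?gt_eqF// => /(_ isT).
move=> /eqP; rewrite eqr_div ?pnatr_eq0 -?lt0n// -!natrM eqr_nat => /eqP e.
have rr : r = r'.
  apply/eqP; rewrite eqn_dvd; apply/andP; split.
    by rewrite -(Gauss_dvdl _ co) -e dvdn_mulr.
  by rewrite -(Gauss_dvdl _ co') e dvdn_mulr.
subst r'; split=> //; apply/eqP; rewrite -(eqn_pmul2l r0) e eqxx //.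
Qed.

(* Main.v *)
Require Import Defs.
From mathcomp Require Import all_boot all_order all_algebra.
From mathcomp Require Import finmap.
From mathcomp Require Import all_classical all_reals all_analysis.
From mathcomp Require Import zify ring lra.

Set Implicit Arguments.
Unset Strict Implicit.
Unset Printing Implicit Defensive.

Import Order.TTheory GRing.Theory Num.Theory.
Local Open Scope classical_set_scope.
Local Open Scope ring_scope.

(** The estimate for [c_coef] is immediate: as soon as [b > a], the
    decomposition of [a] is [(a, 1)], and the two floors are [b / a + O(1)] and
    at most [a].

    For the complexity write [n = M + 1] and [N = a ^ M], and take [b] larger
    than [a] and [N].  Leading digits only see the mantissa [x] in [[1, b)] of
    [a ^ m], where [a ^ m = x * b ^ k].  Since [x < b] and [a ^ i <= b], the
    [i]-th digit of the block is the floor of [a ^ i * x] as long as this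
    product is below [b] (the digit has not wrapped around), and the floor of
    [a ^ i * x / b] afterwards.  All wrapped digits are determined by
    [W = floor (N * x / b)], an integer below [N], which takes boundedly many
    values.  If [u] is the last index whose digit is not wrapped, all unwrapped
    digits are determined by [v = floor (a ^ u * x)]; here [u = M - e] with [e]
    the least exponent such that [W < a ^ e], that is [e = up_log a W.+1].
    Conversely the block determines [(W, v)], because an unwrapped [i]-th digit
    is at least [a ^ i] and a wrapped one is less than [a ^ i], so that the two
    kinds can be told apart ([cell_code_inj]).

    Each pair [(W, v)] is a subinterval of [[1, b)], and a nonempty one is
    visited by some mantissa because the mantissas are dense
    ([dense_mantissa]); this is where squarefreeness enters, as together
    with [a < b] it makes [ln a / ln b] irrational.  So the complexity is the number of pairs
    ([complexity_cells]).  For a fixed [W], [x] ranges over an interval of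
    length [b / N + O(1)], hence [v] takes [a ^ u * b / N + O(1) = b / a ^ e + O(1)]
    values ([cell_size_approx]).  There are [a ^ e - a ^ (e - 1)] values of [W]
    for each [e] between 1 and [M], and one for [e = 0], so the sum over [W] is
    [b * (1 + M * (1 - 1 / a)) + O(1)] ([sum_inv_up_log]), which is
    [(1 - 1 / a) * n * b + b / a + O(1)]. *)

(** * Density of the mantissas of the powers of [a] *)

(** A prime factor of [b / gcd (a, b)] would divide [a], hence also the gcd, and
    its square would divide [b]. *)
Lemma squarefree_dvdn_exp (a b h : nat) :
  (0 < b)%N -> squarefree b -> (b %| a ^ h)%N -> (b %| a)%N.
Proof.
move=> b0 sf bah.
have g0 : (0 < gcdn a b)%N by rewrite gcdn_gt0 b0 orbT.
have [c def_b] := dvdnP (dvdn_gcdr a b).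
have [c1|c1] := leqP c 1; last first.
  have cb : (pdiv c %| b)%N by rewrite def_b dvdn_mulr ?pdiv_dvd.
  have ca : (pdiv c %| a)%N.
    have := dvdn_trans cb bah; rewrite Euclid_dvdX ?pdiv_prime//.
    by case/andP.
  have : (pdiv c ^ 2 %| b)%N.
    by rewrite def_b -mulnn dvdn_mul ?pdiv_dvd// dvdn_gcd ca.
  by move/sf => p1; have := pdiv_prime c1; rewrite p1.
have c_eq1 : c = 1%N by case: c c1 def_b => [|[|]]//; rewrite mul0n; lia.
by rewrite def_b c_eq1 mul1n dvdn_gcdl.
Qed.

(** Multiplicative independence of [a] and [b]: if [a ^ h] were a power of [b],
    then [b] would divide [a ^ h], hence [a], against [a < b]. *)
Lemma mul_exp_neq1 (R : realType) (a b h : nat) (k : int) :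
  (2 <= a)%N -> (a < b)%N -> squarefree b -> (1 <= h)%N ->
  (a%:R ^+ h * b%:R ^ k : R) != 1.
Proof.
move=> a2 ab sf h1; apply/eqP => E.
have ah : 1 < (a%:R ^+ h : R) by rewrite exprn_egt1 ?ltr1n//; lia.
have b1 : 1 < b%:R :> R by rewrite ltr1n; lia.
have b0 : 0 < b%:R :> R by lra.
case: k E => [k|k] E.
  have : 1 <= (b%:R ^+ k : R) by rewrite exprn_ege1 // ltW.
  by rewrite /exprz in E; move: E ah => E ah H; nra.
rewrite /exprz in E.
have bk0 : b%:R ^+ k.+1 != 0 :> R by rewrite expf_neq0 // gt_eqF.
move/(congr1 ( *%R^~ (b%:R ^+ k.+1))): E; rewrite /= divfK // mul1r => E.
move: E => /eqP; rewrite -!natrX eqr_nat => /eqP E.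
have : (b %| a)%N.
  by apply: (@squarefree_dvdn_exp a b h); [lia|by []|rewrite E expnS dvdn_mulr].
by move/dvdn_leq; lia.
Qed.

(** Pigeonhole: among [M + 2] multiples of [t], two have fractional parts in the
    same interval of length [1 / (M + 1) < e]. *)
Lemma dirichlet_approx (R : realType) (t e : R) : 0 < e ->
  exists (h : nat) (k : int), (1 <= h)%N /\ `|h%:R * t + k%:~R| < e.
Proof.
move=> e0; pose M := Num.truncn e^-1; have Me : e^-1 < M.+1%:R.
  by rewrite /M; have /truncn_itv/andP[] : 0 <= e^-1 by rewrite invr_ge0 ltW.
have Mp : 0 < M.+1%:R :> R by rewrite ltr0n.
pose fr (i : nat) : R := i%:R * t - (Num.floor (i%:R * t))%:~R.
have fr01 i : 0 <= fr i < 1.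
  by rewrite /fr; have := floor_itv (i%:R * t); rewrite intrD; lra.
have frM i : 0 <= fr i * M.+1%:R < M.+1%:R.
  by have := fr01 i; move: (fr i) M.+1%:R Mp => x y *; nra.
pose f (i : 'I_M.+2) : 'I_M.+1 := inord (Num.truncn (fr i * M.+1%:R)).
have /injectivePn[i [j ij fij]] : ~~ injectiveb f.
  by apply/negP => /injectiveP /leq_card; rewrite !card_ord ltnn.
have key : `|fr i - fr j| < e.
  have fE l : (f l : nat) = Num.truncn (fr l * M.+1%:R).
    rewrite inordK //; have /andP[h0 h1] := frM l.
    by rewrite -(ltr_nat R); have /andP[h2 _] := truncn_itv h0; lra.
  have := fE i; rewrite fij fE => tij.
  have /andP[h0 _] := frM i; have /andP[k0 _] := frM j.
  have /andP[h1 h2] := truncn_itv h0; have /andP[k1 k2] := truncn_itv k0.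
  rewrite tij in k1 k2; rewrite -[_.+1%:R in ltRHS]natr1 in h2 k2.
  have : `|fr i - fr j| * M.+1%:R < 1.
    rewrite -(gtr0_norm Mp) -normrM mulrBl ltr_norml; lra.
  have : 1 < e * M.+1%:R by rewrite -ltr_pdivrMl // mulr1.
  by move=> A B; rewrite -(ltr_pM2r Mp); lra.
wlog ltij : i j ij fij key / (i < j)%N.
  move=> W; case: (ltngtP i j) => c; first exact: (W i j).
    by apply: (W j i); rewrite // 1?eq_sym // distrC.
  by move/eqP: ij; case; exact/val_inj.
exists (j - i)%N, (Num.floor (i%:R * t) - Num.floor (j%:R * t)); split; first by lia.
rewrite natrB 1?ltnW// intrB; move: key; rewrite distrC /fr.
by congr (`|_| < _); ring.
Qed.

(** The multiples of a step shorter than an interval cannot jump over it. *)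
Lemma multiple_between (R : realType) (al be d : R) :
  0 <= al -> 0 < d -> d < be - al ->
  exists2 j : nat, (1 <= j)%N & al < j%:R * d < be.
Proof.
move=> al0 d0 db; exists (Num.truncn (al / d)).+1 => //.
have /truncn_itv/andP[h1 h2] : 0 <= al / d by rewrite divr_ge0// ltW.
move: h1 h2; rewrite ler_pdivlMr// ltr_pdivrMr// -natr1 => h1 h2.
by rewrite h2 /=; move: h1; rewrite mulrDl mul1r; lra.
Qed.

(** Kronecker's theorem in dimension one, for the forward orbit of the rotation
    by [t]: a small nonzero [d = h * t + k] is iterated upwards from 0 or
    downwards from 1 according to its sign, so that [t] is always taken with a
    positive multiple. *)
Lemma dense_rotation (R : realType) (t al be : R) :
  (forall (h : nat) (k : int), (1 <= h)%N -> h%:R * t + k%:~R != 0) ->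
  0 <= al -> al < be -> be <= 1 ->
  exists (m : nat) (k : int), (1 <= m)%N /\ al < m%:R * t + k%:~R < be.
Proof.
move=> irr al0 ab b1.
have [h [k [h1 hk]]] := @dirichlet_approx R t (be - al) ltac:(lra).
have := irr h k h1; move: hk.
rewrite ltr_norml neq_lt => /andP[lo hi] /orP[neg|pos].
  (* the reflection [y -> 1 - y] turns the downward walk into an upward one *)
  have [j j1 jd] := @multiple_between R (1 - be) (1 - al) (- (h%:R * t + k%:~R))
    ltac:(lra) ltac:(lra) ltac:(lra).
  exists (j * h)%N, (j%:Z * k + 1); split; first by lia.
  by rewrite intrD intrM natrM -pmulrn; move: jd; lra.
have [j j1 jd] := @multiple_between R al be _ al0 pos ltac:(lra).
exists (j * h)%N, (j%:Z * k); split; first by lia.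
by rewrite intrM natrM -pmulrn; move: jd; lra.
Qed.

Lemma ln_exprz (R : realType) (x : R) (k : int) : 0 < x ->
  ln (x ^ k) = k%:~R * ln x.
Proof.
move=> x0; case: k => [k|k]; first by rewrite /exprz lnXn// -pmulrn mulr_natl.
by rewrite [X in ln X]/exprz NegzE lnV ?posrE ?exprn_gt0// lnXn// intrN mulNr -pmulrn mulr_natl.
Qed.

(** The logarithmic form of [dense_rotation] with [t = ln a / ln b]. *)
Lemma dense_mantissa (R : realType) (a b : nat) (al be : R) :
  (2 <= a)%N -> (a < b)%N -> squarefree b -> 1 <= al -> al < be -> be <= b%:R ->
  exists (m : nat) (k : int), (1 <= m)%N /\ al < a%:R ^+ m * b%:R ^ k < be.
Proof.
move=> a2 ab sf al1 albe beb.
have a0 : 0 < a%:R :> R by rewrite ltr0n; lia.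
have b0 : 0 < b%:R :> R by rewrite ltr0n; lia.
have B0 : 0 < ln b%:R :> R by rewrite ln_gt0 // ltr1n; lia.
have lnE (m : nat) (k : int) : ln (a%:R ^+ m * b%:R ^ k) / ln b%:R =
    m%:R * (ln a%:R / ln b%:R) + k%:~R :> R.
  rewrite lnM ?posrE ?exprn_gt0 ?exprz_gt0 // lnXn // ln_exprz // mulrDl.
  by rewrite mulfK ?gt_eqF // mulrA mulr_natl.
have irr (h : nat) (k : int) : (1 <= h)%N ->
    h%:R * (ln a%:R / ln b%:R) + k%:~R != 0 :> R.
  move=> h1; rewrite -lnE mulf_neq0 ?invr_eq0 ?(gt_eqF B0) //.
  by rewrite ln_eq0 ?mul_exp_neq1 // mulr_gt0 ?exprn_gt0 ?exprz_gt0.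
have lo : 0 <= ln al / ln b%:R by apply: divr_ge0; [exact: ln_ge0|exact: ltW].
have lt : ln al / ln b%:R < ln be / ln b%:R.
  by rewrite ltr_pM2r ?invr_gt0// ltr_ln ?posrE//; lra.
have hi : ln be / ln b%:R <= 1.
  by rewrite ler_pdivrMr// mul1r ler_ln ?posrE//; lra.
have [m [k [m1 mk]]] := dense_rotation irr lo lt hi.
exists m, k; split => //; move: mk.
rewrite -lnE !ltr_pM2r ?invr_gt0// !ltr_ln ?posrE ?mulr_gt0 ?exprn_gt0 ?exprz_gt0//; lra.
Qed.

(** * The cell of a mantissa and its block of digits *)

(** The block read off from [W] (wrapped digits) and [v] (unwrapped digits). *)
Definition cell_code (a M W v : nat) : M.+1.-tuple nat :=
  let u := (M - up_log a W.+1)%N in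
  [tuple if (i <= u)%N then v %/ a ^ (u - i) else W %/ a ^ (M - i) | i < M.+1]%N.

(** The integers [v] for which some [x] in [[1, b)] satisfies
    [floor (a ^ M * x / b) = W] and [floor (a ^ u * x) = v] are those in
    [[cell_lo, cell_hi)]; [cell_boundsE] gives the inequalities behind these
    formulas, and the term [a ^ u] of the maximum accounts for [x >= 1].  This
    is meant for [W < a ^ M <= b]. *)
Definition cell_lo (a b M W : nat) : nat :=
  maxn (a ^ (M - up_log a W.+1)) (W * b %/ a ^ up_log a W.+1).

Definition cell_hi (a b W : nat) : nat :=
  ((W.+1 * b).-1 %/ a ^ up_log a W.+1).+1.

Lemma leading_digitE (R : realType) (b : nat) (x : R) (d : nat) :
  is_leading_digit b x d -> leading_digit b x = d.
Proof.
move=> xd; rewrite /leading_digit; case: xgetP => [e _ xe|/(_ d)]; last by case.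
exact: leading_digit_uniq xe xd.
Qed.

(** Nested floors: the floor of [y] is obtained from the floor [q] of
    [a ^ l * y] by integer division. *)
Lemma floor_divn (R : realType) (a l q : nat) (y : R) : (0 < a)%N ->
  q%:R <= a%:R ^+ l * y < q.+1%:R ->
  (q %/ a ^ l)%:R <= y < (q %/ a ^ l).+1%:R.
Proof.
move=> a0 /andP[lo hi]; have al0 : (0 < a ^ l)%N by rewrite expn_gt0 a0.
have al0R : 0 < a%:R ^+ l :> R by rewrite exprn_gt0 // ltr0n.
apply/andP; split.
  rewrite -(ler_pM2l al0R); apply: le_trans lo.
  by rewrite -natrX -natrM ler_nat mulnC leq_trunc_div.
rewrite -(ltr_pM2l al0R); apply: lt_le_trans hi _.
by rewrite -natrX -natrM ler_nat mulnC -ltn_divLR.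
Qed.

Lemma up_log_le (a M W : nat) : (2 <= a)%N -> (W < a ^ M)%N ->
  (up_log a W.+1 <= M)%N.
Proof. by move=> a2 WM; exact: up_log_min. Qed.

(** With [x] the mantissa of [a ^ m], the unwrapped digits sit at the scale
    [b ^ k] and are nested floors of [v]; the wrapped ones sit at the scale
    [b ^ (k + 1)] and are nested floors of [W]. *)
Lemma block_cell (R : realType) (a b M m W v : nat) (x : R) (k : int) :
  (2 <= a)%N -> (a ^ M <= b)%N -> (1 < b)%N -> (W < a ^ M)%N ->
  let e := up_log a W.+1 in
  a%:R ^+ m = x * b%:R ^ k -> (a ^ (M - e) <= v < b)%N ->
  W%:R * b%:R <= a%:R ^+ M * x < W.+1%:R * b%:R ->
  v%:R <= a%:R ^+ (M - e) * x < v.+1%:R ->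
  block (a%:R : R) b M.+1 m = cell_code a M W v.
Proof.
move=> a2 aMb b1 WM e axm /andP[va vb] Wx vx.
have eM : (e <= M)%N by exact: up_log_le.
have b0 : 0 < b%:R :> R by rewrite ltr0n; lia.
have scale (d : nat) (y : R) (j : int) :
  d%:R <= y < d.+1%:R -> d%:R * b%:R ^ j <= y * b%:R ^ j < d.+1%:R * b%:R ^ j.
  have bj : 0 < b%:R ^ j :> R by exact: exprz_gt0.
  by rewrite ler_pM2r // ltr_pM2r.
apply: eq_from_tnth => i; rewrite !tnth_mktuple /= -/e.
apply: leading_digitE; have iM : (i <= M)%N by rewrite -ltnS.
case: ifP => iu.
  split.
    have p0 : (0 < a ^ (M - e - i))%N by rewrite expn_gt0; lia.
    have : (v %/ a ^ (M - e - i) <= v)%N by exact: leq_div.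
    suff : (1 <= v %/ a ^ (M - e - i))%N by lia.
    by rewrite divn_gt0 // (leq_trans _ va) // leq_pexp2l //; lia.
  exists k; have -> : a%:R ^+ (m + i) = a%:R ^+ i * x * b%:R ^ k.
    by rewrite exprD axm mulrC mulrA.
  apply: scale.
  apply: floor_divn; first by lia.
  by rewrite mulrA -exprD subnK.
split.
  have p0 : (0 < a ^ (M - i))%N by rewrite expn_gt0; lia.
  have : (W %/ a ^ (M - i) <= W)%N by exact: leq_div.
  suff : (1 <= W %/ a ^ (M - i))%N by lia.
  (* [i > M - e], so [W < a ^ (M - i)] would contradict the minimality of [e] *)
  rewrite divn_gt0 // leqNgt; apply/negP => Wlt.
  have := up_log_min a2 Wlt; rewrite -/e; lia.
exists (k + 1); have -> : a%:R ^+ (m + i) = (a%:R ^+ i * x / b%:R) * b%:R ^ (k + 1).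
  by rewrite exprD axm expfzDr ?gt_eqF // expr1z; field; rewrite gt_eqF.
apply: scale; apply: floor_divn; first by lia.
rewrite 2!mulrA -exprD subnK //.
by rewrite ler_pdivlMr // ltr_pdivrMr.
Qed.

(** This is the bound [v < b] in the form [cell_hi <= b]; it comes from
    [W.+1 <= a ^ e]. *)
Lemma cell_hi_le (a b M W : nat) : (2 <= a)%N -> (0 < b)%N -> (W < a ^ M)%N ->
  (cell_hi a b W <= b)%N.
Proof.
move=> a2 b0 WM; rewrite /cell_hi ltn_divLR ?expn_gt0; last by lia.
have := up_logP W.+1 a2; move: (a ^ _)%N => c; nia.
Qed.

Lemma cell_boundsE (a b M W v : nat) : (2 <= a)%N -> (0 < b)%N ->
  let e := up_log a W.+1 in
  (cell_lo a b M W <= v < cell_hi a b W)%N =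
  [&& a ^ (M - e) <= v, W * b < v.+1 * a ^ e & v * a ^ e < W.+1 * b]%N.
Proof.
move=> a2 b0 e; have p0 : (0 < a ^ e)%N by rewrite expn_gt0; lia.
rewrite /cell_lo /cell_hi -/e geq_max ltnS leq_divRL // -andbA; congr (_ && _).
rewrite -ltnS ltn_divLR //; congr (_ && _).
by rewrite -[in LHS]ltnS prednK ?muln_gt0.
Qed.

(** The last digit is either [W] itself, below [a ^ M], or, when [W = 0], it is
    [v], at least [a ^ M].  So it determines [W], thus [u], and then [v] is the
    [u]-th digit. *)
Lemma cell_code_inj (a b M W W' v v' : nat) : (2 <= a)%N ->
  (W < a ^ M)%N -> (W' < a ^ M)%N ->
  (cell_lo a b M W <= v)%N -> (cell_lo a b M W' <= v')%N ->
  cell_code a M W v = cell_code a M W' v' -> W = W' /\ v = v'.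
Proof.
move=> a2 WM WM' lo lo' E.
have E' (i : 'I_M.+1) := congr1 (fun t => tnth t i) E.
have eM := up_log_le a2 WM; have eM' := up_log_le a2 WM'.
have WW : W = W'.
  have := E' ord_max; rewrite !tnth_mktuple /= subnn expn0 !divn1.
  move: lo lo'; rewrite !geq_max => /andP[lo _] /andP[lo' _].
  have up0 X : (X < a ^ M)%N -> up_log a X.+1 = 0%N -> X = 0%N.
    by move=> _ /eqP; rewrite up_log_eq0; lia.
  case: (posnP (up_log a W.+1)) => [e0|e0];
  case: (posnP (up_log a W'.+1)) => [e0'|e0'].
  - by rewrite (up0 _ WM) // (up0 _ WM').
  - rewrite e0 subn0 leqnn subnn expn0 divn1 ifF; last by lia.
    by move: lo; rewrite e0 subn0; lia.
  - rewrite e0' subn0 leqnn subnn expn0 divn1 ifF; last by lia.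
    by move: lo'; rewrite e0' subn0; lia.
  - by rewrite !ifF //; lia.
split => //; subst W'.
have uM : (M - up_log a W.+1 < M.+1)%N by lia.
have := E' (Ordinal uM); rewrite !tnth_mktuple /= leqnn subnn expn0 !divn1 //.
Qed.

(** * The complexity counts the cells *)

(** The cell of [(W, v)] is the intersection of two intervals of mantissas, one
    for each floor; the bounds on [v] say that its interior is nonempty, so a
    mantissa falls into it. *)
Lemma cell_codes_occur (R : realType) (a b M W v : nat) :
  (2 <= a)%N -> (a < b)%N -> (a ^ M <= b)%N -> squarefree b ->
  (W < a ^ M)%N -> (cell_lo a b M W <= v < cell_hi a b W)%N ->
  exists2 m, (1 <= m)%N & block (a%:R : R) b M.+1 m = cell_code a M W v.
Proof.
move=> a2 ab aMb sf WM vW; have b0 : (0 < b)%N by lia.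
have vb : (v < b)%N by have := cell_hi_le a2 b0 WM; lia.
move: vW; rewrite cell_boundsE // => /and3P[]; set e := up_log a W.+1 => pv lo hi.
have eM : (e <= M)%N by exact: up_log_le.
have b0R : 0 < b%:R :> R by rewrite ltr0n.
set p := (a%:R ^+ (M - e) : R); set c := (a%:R ^+ e : R).
have p0 : 0 < p by rewrite exprn_gt0 // ltr0n; lia.
have c0 : 0 < c by rewrite exprn_gt0 // ltr0n; lia.
have pcE : a%:R ^+ M = p * c by rewrite -exprD subnK.
have pc0 : 0 < p * c by rewrite mulr_gt0.
have pvR : p <= v%:R by rewrite /p -natrX ler_nat.
have loR : W%:R * b%:R < v.+1%:R * c by rewrite /c -natrX -!natrM ltr_nat.
have hiR : v%:R * c < W.+1%:R * b%:R by rewrite /c -natrX -!natrM ltr_nat.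
have WMR : W.+1%:R <= p * c by rewrite -pcE -natrX ler_nat.
pose al := Num.max (v%:R / p) (W%:R * b%:R / (p * c)).
pose be := Num.min (v.+1%:R / p) (W.+1%:R * b%:R / (p * c)).
have al1 : 1 <= al by rewrite le_max ler_pdivlMr // mul1r pvR.
have beb : be <= b%:R.
  rewrite ge_min; apply/orP; right.
  by rewrite ler_pdivrMr // [leRHS]mulrC ler_pM2r.
have albe : al < be.
  rewrite gt_max !lt_min !ltr_pM2r ?invr_gt0 // !ltr_nat !leqnn /=.
  have vE (y : R) : y / p = y * c / (p * c) by field; rewrite !gt_eqF.
  by rewrite !vE !ltr_pM2r ?invr_gt0 // loR hiR.
have [m [k [m1]]] := dense_mantissa a2 ab sf al1 albe beb.
rewrite gt_max lt_min !ltr_pdivrMr // !ltr_pdivlMr // -!andbA.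
set x := a%:R ^+ m * b%:R ^ k => /and4P[x1 x2 x3 x4].
have axm : a%:R ^+ m = x * b%:R ^ (- k).
  by rewrite /x -[RHS]mulrA -(expfzDr k (- k) (lt0r_neq0 b0R)) subrr expr0z mulr1.
have xW : W%:R * b%:R <= a%:R ^+ M * x < W.+1%:R * b%:R.
  by rewrite pcE [_ * x]mulrC x4 andbT ltW.
have xv : v%:R <= p * x < v.+1%:R by rewrite [_ * x]mulrC x3 andbT ltW.
have pvb : (a ^ (M - e) <= v < b)%N by rewrite pv.
exists m; first exact: m1.
exact: (block_cell a2 aMb (leq_ltn_trans (ltnW a2) ab) WM axm pvb xW xv).
Qed.

Lemma block_in_cell (R : realType) (a b M m : nat) :
  (2 <= a)%N -> (a < b)%N -> (a ^ M <= b)%N ->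
  exists W v, [/\ (W < a ^ M)%N, (cell_lo a b M W <= v < cell_hi a b W)%N &
    block (a%:R : R) b M.+1 m = cell_code a M W v].
Proof.
move=> a2 ab aMb; have b0 : (0 < b)%N by lia.
have b0R : 0 < b%:R :> R by rewrite ltr0n.
have b1 : (1 < b)%N by lia.
have am0 : (0 < a ^ m)%N by rewrite expn_gt0; lia.
pose t := trunc_log b (a ^ m).
have /andP[t1 t2] := trunc_log_bounds b1 am0.
rewrite -/t expnS in t1 t2.
pose x : R := a%:R ^+ m / b%:R ^+ t.
have x1 : 1 <= x.
  by rewrite ler_pdivlMr ?exprn_gt0 // mul1r -!natrX ler_nat.
have x0 : 0 <= x by exact: le_trans ler01 x1.
have xb : x < b%:R.
  by rewrite ltr_pdivrMr ?exprn_gt0 // -!natrX -natrM ltr_nat.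
have aM0 : 0 < a%:R ^+ M :> R by rewrite exprn_gt0 // ltr0n; lia.
pose W := Num.truncn (a%:R ^+ M * x / b%:R).
have /andP[W1 W2] : W%:R * b%:R <= a%:R ^+ M * x < W.+1%:R * b%:R.
  rewrite -ler_pdivlMr // -ltr_pdivrMr //; apply: truncn_itv.
  exact: divr_ge0 (mulr_ge0 (ltW aM0) x0) (ltW b0R).
have WM : (W < a ^ M)%N.
  rewrite -(ltr_nat R) natrX -(ltr_pM2r b0R); apply: le_lt_trans W1 _.
  by rewrite ltr_pM2l.
pose e := up_log a W.+1; have eM : (e <= M)%N by exact: up_log_le.
set p := (a%:R ^+ (M - e) : R); set c := (a%:R ^+ e : R).
have p0 : 0 < p by rewrite exprn_gt0 // ltr0n; lia.
have c0 : 0 < c by rewrite exprn_gt0 // ltr0n; lia.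
have pcE : a%:R ^+ M = p * c by rewrite -exprD subnK.
pose v := Num.truncn (p * x).
have /andP[v1 v2] : v%:R <= p * x < v.+1%:R.
  exact: truncn_itv (mulr_ge0 (ltW p0) x0).
have vW : (cell_lo a b M W <= v < cell_hi a b W)%N.
  rewrite cell_boundsE // -/e; apply/and3P; split.
  - rewrite -ltnS -(ltr_nat R) natrX; apply: le_lt_trans v2.
    by rewrite ler_peMr // ltW.
  - rewrite -(ltr_nat R) !natrM natrX -/c; apply: le_lt_trans W1 _.
    by rewrite pcE mulrAC ltr_pM2r.
  - rewrite -(ltr_nat R) !natrM natrX -/c; apply: le_lt_trans W2.
    by rewrite pcE mulrAC ler_pM2r.
exists W, v; split => //.
have axm : a%:R ^+ m = x * b%:R ^ t%:Z.
  by rewrite /x /exprz divfK // expf_neq0 // gt_eqF.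
have pvb : (a ^ (M - e) <= v < b)%N.
  have := vW; rewrite cell_boundsE // => /and3P[-> _ _] /=.
  by case/andP: vW => _ /leq_trans; apply; exact: cell_hi_le b0 WM.
have xW : W%:R * b%:R <= a%:R ^+ M * x < W.+1%:R * b%:R by rewrite W1.
have xv : v%:R <= p * x < v.+1%:R by rewrite v1.
exact: (block_cell a2 aMb b1 WM axm pvb xW xv).
Qed.

Lemma complexity_cells (R : realType) (a b M : nat) :
  (2 <= a)%N -> (a < b)%N -> (a ^ M <= b)%N -> squarefree b ->
  complexity (a%:R : R) b M.+1 =
    (\sum_(W < a ^ M) (cell_hi a b W - cell_lo a b M W))%N.
Proof.
move=> a2 ab aMb sf.
pose vs W := iota (cell_lo a b M W) (cell_hi a b W - cell_lo a b M W).
have vsE W v : (v \in vs W) = (cell_lo a b M W <= v < cell_hi a b W)%N.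
  rewrite mem_iota; case: (leqP (cell_lo a b M W) (cell_hi a b W)) => c.
    by rewrite subnKC.
  by apply/idP/idP => /andP[]; lia.
pose s := [seq cell_code a M W v | W <- iota 0 (a ^ M), v <- vs W].
have us : uniq s.
  apply: allpairs_uniq_dep; [exact: iota_uniq|by move=> W _; exact: iota_uniq|].
  move=> _ _ /allpairsPdep[W [v [WM vW ->]]] /allpairsPdep[W' [v' [WM' vW' ->]]] /=.
  rewrite !vsE in vW vW'; rewrite !mem_iota /= add0n in WM WM'.
  move: vW vW' => /andP[vW _] /andP[vW' _].
  by move/(cell_code_inj a2 WM WM' vW vW') => [-> ->].
have -> : complexity (a%:R : R) b M.+1 = size s.
  rewrite /complexity -(undup_id us) -(size_seq_fset tt) -[X in _ = #|`X|]set_fsetK.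
  congr #|` fset_set _|; apply/seteqP; split => [_ [m m1 <-]|y] /=.
    have [W [v [WM vW ->]]] := @block_in_cell R a b M m a2 ab aMb.
    change (cell_code a M W v \in seq_fset tt s).
    rewrite seq_fsetE; apply/allpairsPdep; exists W, v.
    by rewrite vsE mem_iota.
  change (y \in seq_fset tt s -> exists2 m, (1 <= m)%N & block (a%:R : R) b M.+1 m = y).
  rewrite seq_fsetE => /allpairsPdep[W [v [WM vW ->]]].
  rewrite vsE in vW; rewrite mem_iota /= add0n in WM.
  by have [m m1 <-] := @cell_codes_occur R a b M W v a2 ab aMb sf WM vW; exists m.
rewrite size_allpairs_dep sumnE big_map -[X in iota 0 X]subn0.
by rewrite -/(index_iota 0 (a ^ M)) big_mkord; apply: eq_bigr => W _; rewrite size_iota.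
Qed.

(** * Estimates *)

(** In the induction step each of the [a ^ M.+1 - a ^ M] new terms equals
    [1 / a ^ M.+1], so that together they add [1 - 1 / a]. *)
Lemma sum_inv_up_log (R : numFieldType) (a M : nat) : (2 <= a)%N ->
  \sum_(W < a ^ M) (a%:R ^+ up_log a W.+1)^-1 = 1 + M%:R * (1 - 1 / a%:R) :> R.
Proof.
move=> a2; have a0 : 0 < a%:R :> R by rewrite ltr0n; lia.
elim: M => [|M IH].
  by rewrite expn0 big_ord1 /= up_log1 expr0 invr1; ring.
have aM : (a ^ M <= a ^ M.+1)%N by rewrite leq_pexp2l //; lia.
rewrite -(big_mkord xpredT (fun W => (a%:R ^+ up_log a W.+1)^-1)).
rewrite (@big_cat_nat _ _ _ (a ^ M)) //= big_mkord IH.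
have -> : \sum_(a ^ M <= W < a ^ M.+1) (a%:R ^+ up_log a W.+1)^-1 =
    \sum_(a ^ M <= W < a ^ M.+1) (a%:R ^+ M.+1)^-1 :> R.
  by apply: eq_big_nat => W /andP[W1 W2]; rewrite (@up_log_eq a M) // ltnS W1.
rewrite sumr_const_nat -(mulr_natl (_^-1)) natrB // !natrX exprS -(natr1 M).
by field; rewrite ?expf_neq0 ?gt_eqF.
Qed.

(** The two floors in [cell_lo] and [cell_hi] cost less than 2, and the maximum
    in [cell_lo] raises it by at most [a ^ (M - e) <= a ^ M]. *)
Lemma cell_size_approx (R : realFieldType) (a b M W : nat) :
  (2 <= a)%N -> (a ^ M <= b)%N -> (W < a ^ M)%N ->
  `|(cell_hi a b W - cell_lo a b M W)%:R - b%:R / a%:R ^+ up_log a W.+1|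
    <= (a ^ M)%:R + 1 :> R.
Proof.
move=> a2 aMb WM; have N0 : (0 < a ^ M)%N by rewrite expn_gt0; lia.
have b0 : (0 < b)%N by lia.
have eM := up_log_le a2 WM.
have NE : (a ^ M = a ^ (M - up_log a W.+1) * a ^ up_log a W.+1)%N.
  by rewrite -expnD subnK.
have c0 : (0 < a ^ up_log a W.+1)%N by rewrite expn_gt0; lia.
rewrite /cell_hi /cell_lo -natrX.
move: (a ^ (M - _))%N (a ^ up_log _ _)%N NE c0 => p c NE c0.
have := divn_eq (W.+1 * b).-1 c; have := ltn_pmod (W.+1 * b).-1 c0.
have := divn_eq (W * b) c; have := ltn_pmod (W * b) c0.
move: (_ %/ _)%N (_ %% _)%N => l r rc lE.
move: (_ %/ _)%N (_ %% _)%N => h r' rc' hE.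
have hE' : (h * c + r'.+1 = W * b + b)%N by rewrite addnS -hE mulSn; lia.
have lh : (l <= h.+1)%N by rewrite -(leq_pmul2r c0) mulSn; lia.
have pc : (p * c <= b)%N by rewrite -NE.
have ph : (p <= h.+1)%N by rewrite -(leq_pmul2r c0) mulSn; lia.
have pN : (p <= a ^ M)%N by rewrite NE leq_pmulr.
have zE : ((h.+1 - l) * c + r + r'.+1 = b + c + r * 2)%N by rewrite mulnBl mulSn; lia.
have z1 : (h.+1 - maxn p l <= h.+1 - l)%N by lia.
have z2 : (h.+1 - l <= h.+1 - maxn p l + p)%N by lia.
have upper : ((h.+1 - maxn p l) * c < b + 2 * c)%N.
  by have := leq_mul z1 (leqnn c); lia.
have lower : (b <= (h.+1 - maxn p l + p + 1) * c)%N.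
  by have := leq_mul z2 (leqnn c); rewrite !mulnDl mul1n; lia.
have c0R : 0 < c%:R :> R by rewrite ltr0n.
rewrite ler_norml -(ler_pM2r c0R) -[X in _ && X](ler_pM2r c0R) !mulrBl divfK ?gt_eqF //.
have pNR : p%:R <= (a ^ M)%:R :> R by rewrite ler_nat.
have N1 : 1 <= (a ^ M)%:R :> R by rewrite ler1n.
move: upper lower; rewrite -(ltr_nat R) -(ler_nat R) ?(natrM, natrD).
move: (_ - _)%N => z up low; apply/andP; split; nra.
Qed.

Lemma complexity_approx (R : realType) (a b M : nat) :
  (2 <= a)%N -> (a < b)%N -> (a ^ M <= b)%N -> squarefree b ->
  `|(complexity (a%:R : R) b M.+1)%:R - b%:R * (1 + M%:R * (1 - 1 / a%:R))|
    <= (a ^ M)%:R * ((a ^ M)%:R + 1) :> R.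
Proof.
move=> a2 ab aMb sf; rewrite complexity_cells // -(sum_inv_up_log R M a2).
rewrite natr_sum mulr_sumr -sumrB.
apply: le_trans (ler_norm_sum _ _ _) _.
apply: le_trans (ler_sum _ (fun W _ => cell_size_approx R a2 aMb (ltn_ord W))) _.
by rewrite sumr_const card_ord [leRHS]mulr_natl.
Qed.

Lemma decomposition_nat (a b : nat) : (2 <= a)%N -> (a < b)%N ->
  decomposition a%:R b = (a, 1%N).
Proof.
move=> a2 ab.
have D : is_decomposition a%:R b a 1 0.
  split=> //; [by rewrite expr0z; field|by lia|exact: coprimen1|].
  by rewrite divr1 ltr1n ltr_nat; lia.
rewrite /decomposition; case: xgetP => [[r s] _ [k /= D']|/(_ (a, 1%N))]; last first.
  by case; exists 0.
by have [-> ->] := decomposition_uniq D' D.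
Qed.

Lemma c_coef_approx (R : realFieldType) (a b : nat) : (2 <= a)%N -> (a < b)%N ->
  `|(c_coef a%:R b)%:~R - (1 - 1 / a%:R) * b%:R| <= a%:R + 1 :> R.
Proof.
move=> a2 ab; rewrite /c_coef decomposition_nat // divn1.
have g0 : (0 < gcdn b a)%N by rewrite gcdn_gt0; lia.
have ga : (gcdn b a <= a)%N by apply: dvdn_leq; [lia|exact: dvdn_gcdr].
have a0 : 0 < a%:R :> R by rewrite ltr0n; lia.
have := divn_eq (b - 1) a; have := ltn_pmod (b - 1) (ltnW a2).
move: (_ %/ _)%N (_ %% _)%N => q r ra qE.
have bE : b%:R = q%:R * a%:R + r%:R + 1 :> R.
  by rewrite -natrM -natrD natr1; congr (_%:R); lia.
rewrite !intrB -!pmulrn natrB //.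
have : r%:R < a%:R :> R by rewrite ltr_nat.
have : 1 <= ((gcdn b a)%:R : R) <= a%:R by rewrite ler1n ler_nat g0.
have -> : (1 - 1 / a%:R) * b%:R = b%:R - q%:R - (r%:R + 1) / a%:R :> R.
  by rewrite bE; field; rewrite gt_eqF.
have : 0 <= ((r%:R + 1) / a%:R : R) <= 1.
  by rewrite divr_ge0 ?ler0n ?addr_ge0 //= ler_pdivrMr // mul1r natr1 ler_nat.
rewrite ler_norml; lra.
Qed.

Theorem theorem5p1 (R : realType) (a : nat) (ha : (2 <= a)%N) :
  (exists C : R, \forall b \near \oo, squarefree b ->
     `| (c_coef a%:R b)%:~R - (1 - 1 / a%:R) * b%:R | <= C) /\
  (forall n : nat, (1 <= n)%N ->
     exists C : R, \forall b \near \oo, squarefree b ->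
       `| (complexity (a%:R : R) b n)%:R
          - ((1 - 1 / a%:R) * n%:R * b%:R + b%:R / a%:R) | <= C).
Proof.
split.
  exists (a%:R + 1); near=> b => _; apply: c_coef_approx => //.
  by near: b; exact: nbhs_infty_gt.
case=> // M _; exists ((a ^ M)%:R * ((a ^ M)%:R + 1)); near=> b => sf.
have ab : (a < b)%N by near: b; exact: nbhs_infty_gt.
have aMb : (a ^ M <= b)%N by near: b; exact: nbhs_infty_ge.
have := complexity_approx R ha ab aMb sf.
by congr (`|_ - _| <= _); rewrite -(natr1 M); ring.
Unshelve. all: by end_near.
Qed.
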